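(* Let $(\{\Pi_t : t \in \Omega\}, \mu, \mathbb{P})$ be a generalised family of projections of $\mathbb{R}^n$ of rank $m \geq 1$. Then for every non-empty bounded set $F \subseteq \mathbb{R}^n$, $$\dim_{\mathrm{A}} \Pi_t (F) \geq \inf_{\substack{E \subseteq \mathbb{R}^n :\\ \dim_{\mathrm{H}} E = \dim_{\mathrm{A}} F}} \ \underset{V \sim \mathbb{P}}{\mathrm{essinf}} \ \dim_{\mathrm{A}} \pi_V (E)$$ for $\mu$ almost all $t \in \Omega$.
   Context: $G(n,m)$ is the Grassmannian of $m$-dimensional linear subspaces of $\mathbb{R}^n$, and $\pi_V$ is orthogonal projection of $\mathbb{R}^n$ onto $V \in G(n,m)$. $\dim_{\mathrm{H}}$ denotes Hausdorff dimension. The Assouad dimension $\dim_{\mathrm{A}} F$ of $F\subseteq \mathbb{R}^n$ is the infimum of $\alpha \geq 0$ for which there is $C>0$ such that, for all $x \in F$ and $0<r<R$, the set $F \cap B(x,R)$ may be covered by fewer than $C(R/r)^\alpha$ sets of diameter $r$. $\mathrm{essinf}_{V\sim\mathbb{P}}$ is the essential infimum over $V\in G(n,m)$ with respect to $\mathbb{P}$. The triple $(\{\Pi_t : t \in \Omega\}, \mu, \mathbb{P})$ is a generalised family of projections of $\mathbb{R}^n$ of rank $m \geq 1$ if $\Omega$ is a metric space, $\mu$ is a Borel measure on $\Omega$, $\mathbb{P}$ is a Borel measure on $G(n,m)$ and: (1) (Domain) for all $t \in \Omega$, $\Pi_t$ is a function mapping $\mathbb{R}^n$ into itself; (2) (Differentiability)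 for all $z \in \mathbb{R}^n$, for $\mu$ almost all $t \in \Omega$, $\Pi_t$ is a $C^1$ map of constant rank $m$ in some open neighbourhood of $z$, that is, $\Pi_t$ is continuously differentiable in a neighbourhood of $z$ and the Jacobian $J_{z'}\Pi_t$ is a rank $m$ matrix for all $z'$ sufficiently close to $z$; in particular, for all $z$, the map $T_z : \Omega \to G(n,m)$, $T_z(t) = \ker(J_z \Pi_t)^\perp$, is well-defined $\mu$ almost everywhere; (3) (Absolute continuity) for all $z \in \mathbb{R}^n$, $\mu \circ T_z^{-1} \ll \mathbb{P}$. *)

(* Defs.v *)
From HB Require Import structures.
From mathcomp Require Import all_boot all_order all_algebra.
From mathcomp Require Import sesquilinear.
From mathcomp Require Import all_classical all_reals all_analysis.

Set Implicit Arguments.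
Unset Strict Implicit.
Unset Printing Implicit Defensive.

Import Order.TTheory GRing.Theory Num.Theory.
Import numFieldNormedType.Exports.

Local Open Scope classical_set_scope.
Local Open Scope ring_scope.

(* R^n is 'rV[R]_n.  The norm that MathComp-Analysis puts on it is the sup
   norm; it is used only for its topology and for differentiability.  Every
   metric notion below uses the Euclidean distance. *)

Section euclidean.
Context {R : realType} {n : nat}.
Implicit Types u v x y : 'rV[R]_n.

Definition inner u v : R := \sum_(i < n) u 0 i * v 0 i.

Lemma innerC u v : inner u v = inner v u.
Proof. by apply: eq_bigr => i _; rewrite mulrC. Qed.

Lemma innerBl v : zmod_morphism (inner ^~ v).
Proof.
by move=> u w; rewrite /inner -sumrB; apply: eq_bigr => i _; rewrite !mxE mulrBl.
Qed.

Lemma innerZl v : scalable_for *%R (inner ^~ v).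
Proof.
by move=> a u; rewrite /inner mulr_sumr; apply: eq_bigr => i _; rewrite !mxE mulrA.
Qed.

Lemma innerBr u : zmod_morphism (inner u).
Proof. by move=> v w; rewrite !(innerC u) innerBl. Qed.

Lemma innerZr u : scalable_for (idfun \; *%R) (inner u).
Proof. by move=> a v; rewrite !(innerC u) innerZl. Qed.

HB.instance Definition _ :=
  @isBilinear.Build R _ _ _ *%R (idfun \; *%R) inner
    innerBl innerBr innerZl innerZr.

Lemma inner_hermitian u v : inner u v = (-1) ^+ false * idfun (inner v u).
Proof. by rewrite expr0 mul1r innerC. Qed.

HB.instance Definition _ :=
  @isHermitianSesquilinear.Build R _ false idfun inner inner_hermitian.

Lemma inner_gt0 u : u != 0 -> 0 < inner u u.
Proof.
move=> u0; rewrite lt_neqAle sumr_ge0 ?andbT; last first.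
  by move=> i _; rewrite -expr2 sqr_ge0.
rewrite eq_sym psumr_neq0; last by move=> i _; rewrite -expr2 sqr_ge0.
apply/hasP; have [i ui0] : exists i, u 0 i != 0.
  apply/existsP; apply: contraNT u0 => /existsPn h.
  by apply/eqP/rowP => i; rewrite mxE; apply/eqP/negPn.
by exists i; rewrite ?mem_index_enum//= -expr2 exprn_even_gt0.
Qed.

HB.instance Definition _ := @isDotProduct.Build R _ inner inner_gt0.

Definition edist x y : R := Num.sqrt (inner (x - y) (x - y)).

Definition eball x (r : R) : set 'rV[R]_n := [set y | edist x y <= r].

(* 0 is included so that the diameter of the empty set is 0, not -oo. *)
Definition diam (A : set 'rV[R]_n) : \bar R :=
  ereal_sup (0%E |` [set (edist p.1 p.2)%:E | p in A `*` A]).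

Definition orth_compl (V : {vspace 'rV[R]_n}) : {vspace 'rV[R]_n} :=
  orthov inner V.

Definition orth_proj (V : {vspace 'rV[R]_n}) : 'End('rV[R]_n) :=
  daddv_pi V (orth_compl V).

End euclidean.

Section dimensions.
Context {R : realType} {n : nat}.
Implicit Types F : set 'rV[R]_n.

(* The convention diam(set0)^s = 0 matters for s = 0, where the library has
   0 `^ 0 = 1. *)
Definition hausdorff_cost (s : R) (A : set 'rV[R]_n) : \bar R :=
  if A == set0 then 0%E else (diam A `^ s)%E.

Definition hausdorff_premeasure (s delta : R) F : \bar R :=
  ereal_inf [set (\sum_(0 <= i <oo) hausdorff_cost s (U i))%E | U in
    [set U : (set 'rV[R]_n)^nat |
      F `<=` \bigcup_i U i /\ forall i, (diam (U i) <= delta%:E)%E]].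

Definition hausdorff_measure (s : R) F : \bar R :=
  ereal_sup [set hausdorff_premeasure s delta F | delta in
    [set delta : R | 0 < delta]].

Definition hausdorff_dim F : \bar R :=
  ereal_inf [set s%:E | s in
    [set s : R | 0 <= s /\ hausdorff_measure s F = 0%E]].

Definition assouad_exponent F (alpha : R) : Prop :=
  exists2 C : R, 0 < C & forall x r rho, F x -> 0 < r -> r < rho ->
    exists (N : nat) (U : 'I_N -> set 'rV[R]_n),
      [/\ N%:R < C * (rho / r) `^ alpha,
          forall i, diam (U i) = r%:E &
          F `&` eball x rho `<=` \bigcup_i U i].

Definition assouad_dim F : \bar R :=
  ereal_inf [set alpha%:E | alpha in
    [set alpha : R | 0 <= alpha /\ assouad_exponent F alpha]].

End dimensions.

(* G(n, m).  Taking m in 'I_n.+1, that is m <= n, makes this type nonempty,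
   as the library requires of a measurable space. *)
Record grassmannian (R : realType) (n : nat) (m : 'I_n.+1) : Type :=
  Grassmannian {
    gr_space :> {vspace 'rV[R]_n};
    dim_gr_space : \dim gr_space == m
  }.

Section grassmannian_instances.
Context {R : realType} {n : nat} {m : 'I_n.+1}.

HB.instance Definition _ := [isSub for @gr_space R n m].
HB.instance Definition _ := [Choice of grassmannian R m by <:].

Lemma grassmannian_inhabited :
  \dim <<take m (vbasis {: 'rV[R]_n})>>%VS == m.
Proof.
have : free (vbasis {: 'rV[R]_n}) := basis_free (vbasisP _).
rewrite -{1}(cat_take_drop m (vbasis _)) => /catl_free.
rewrite /free => /eqP ->; rewrite size_takel// size_tuple dimvf /dim/= mul1n.
by rewrite -ltnS.
Qed.

HB.instance Definition _ := isPointed.Build (grassmannian R m)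
  (Grassmannian grassmannian_inhabited).

Definition proj_mx_of (V : grassmannian R m) : 'M[R]_n :=
  lin1_mx (orth_proj V).

(* The usual topology of G(n, m), that of the metric
   d(V, W) = || pi_V - pi_W ||. *)
HB.instance Definition _ :=
  Topological.copy (grassmannian R m) (initial_topology proj_mx_of).

End grassmannian_instances.

(* Nonempty metric spaces: the library requires measurable spaces to be
   pointed. *)
#[short(type="pmetricType")]
HB.structure Definition PointedMetric (K : numDomainType) :=
  {M of Pointed M & Metric K M}.

Definition borel (T : ptopologicalType) : Type :=
  g_sigma_algebraType (@open T).

Section projections.
Context {R : realType} {n : nat}.

(* With row vectors the derivative of f at z is v |-> v *m 'J f z. *)
Definition C1_constant_rank_near (m : nat) (f : 'rV[R]_n -> 'rV[R]_n)
    (z : 'rV[R]_n) : Prop :=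
  \forall z' \near z, [/\ differentiable f z',
    {for z', continuous (jacobian f)} & \rank ('J f z') = m].

Definition ker_perp (f : 'rV[R]_n -> 'rV[R]_n) (z : 'rV[R]_n) :
    {vspace 'rV[R]_n} :=
  orth_compl (lker (linfun (mulmxr ('J f z)))).

Context {m : 'I_n.+1} {Omega : pmetricType R}.
Variable Pi : Omega -> 'rV[R]_n -> 'rV[R]_n.

(* When ker(J_z Pi_t)^perp does not have dimension m the value is a default
   point; for a generalised family of projections this happens only for t in a
   mu-negligible set. *)
Definition tangent_map (z : 'rV[R]_n) (t : Omega) : grassmannian R m :=
  insubd (point : grassmannian R m) (ker_perp (Pi t) z).

(* The map t |-> tangent_map z t is not assumed to be measurable, so absolute
   continuity asks that preimages of P-null sets be mu-negligible, i.e.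
   contained in a mu-null Borel set; for a Borel preimage this is the equality
   mu (T_z^-1 A) = 0. *)
Definition generalised_projections
    (mu : {measure set (borel Omega) -> \bar R})
    (P : {measure set (borel (grassmannian R m)) -> \bar R}) : Prop :=
  [/\ (1 <= m)%N,
      forall z, {ae mu, forall t, C1_constant_rank_near m (Pi t) z} &
      forall z (A : set (borel (grassmannian R m))),
        measurable A -> P A = 0%E -> mu.-negligible (tangent_map z @^-1` A)].

End projections.

(* Main.v *)
From HB Require Import structures.
From mathcomp Require Import all_boot all_order all_algebra.
From mathcomp Require Import sesquilinear.
From mathcomp Require Import all_classical all_reals all_analysis.
From mathcomp Require Import ess_sup_inf.
From mathcomp Require Import finmap ring lra.
Require Import Defs.

Set Implicit Arguments.
Unset Strict Implicit.
Unset Printing Implicit Defensive.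

Import Order.TTheory GRing.Theory Num.Theory.
Import numFieldNormedType.Exports.
Local Open Scope classical_set_scope.
Local Open Scope ring_scope.

(** Zoom into [F] at points [x k] and scales [rho k] tending to [0], with
    [x k] tending to some [z], and let [E] be a limit of the rescaled pieces
    [F `&` B(x k, rho k)] (a weak tangent).  Two facts give the theorem.

    The first is that [E] can be chosen with [hausdorff_dim E = assouad_dim F]
    ([exists_full_dimensional_tangent]).  If [t] is not an Assouad exponent of
    [F], then for every [k] some small piece [F `&` B(x, rho)] has no cover by
    balls of radii [th_i * rho], [2^-k <= th_i <= 1/2], with
    [\sum_i th_i^t <= 1].  Otherwise such covers could be iterated inside one
    another down to any scale [r], and the resulting family of at most
    [C (rho/r)^t] balls would make [t] an exponent
    ([efficient_cover_exponent]).  A cover of [E] of small [t]-cost could be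
    thickened, made finite by compactness, and pulled back to exactly such a
    forbidden cover of a piece of [F]; hence [E] has positive Hausdorff measure
    in every dimension [t < assouad_dim F] ([weak_tangent_measure_neq0]).  The
    bound [hausdorff_dim E <= assouad_dim E <= assouad_dim F] is the easy half.

    The second is that a map which is C^1 near [z] acts on small pieces near
    [z] as its derivative [L = 'J f z] up to a relatively small error, so that
    [L @` E] is seen in [f @` F] at arbitrarily small scales and
    [assouad_dim (L @` E) <= assouad_dim (f @` F)].  The orthogonal projection
    [p] onto the complement of [ker L] has the same kernel as [L], so [|p v|]
    and [|L v|] are comparable and [p @` E] has the Assouad dimension of
    [L @` E] ([assouad_exponent_weak_tangent],
    [assouad_dim_projection_tangent_le]).

    The point [z] and the set [E] do not depend on [t].  For [mu]-almost every
    [t] the map [Pi t] is C^1 near [z], and by absolute continuity the plane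
    [tangent_map Pi z t] avoids the [P]-null set of planes [V] where
    [assouad_dim (orth_proj V @` E)] falls below its essential infimum.

    Limits are taken along an ultrafilter on [nat], which makes the extraction
    of convergent subsequences unnecessary. *)

(** * The Euclidean norm *)

Section euclidean_norm.
Context {R : realType} {n : nat}.
Implicit Types u v w x y z : 'rV[R]_n.

Definition enorm v : R := Num.sqrt (inner v v).

Lemma edistE x y : edist x y = enorm (x - y). Proof. by []. Qed.

Lemma inner_ge0 v : 0 <= inner v v.
Proof. by apply: sumr_ge0 => i _; rewrite -expr2 sqr_ge0. Qed.

Lemma enorm_ge0 v : 0 <= enorm v. Proof. exact: sqrtr_ge0. Qed.

Lemma enormK v : enorm v ^+ 2 = inner v v.
Proof. by rewrite sqr_sqrtr// inner_ge0. Qed.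

Lemma enorm0 : enorm 0 = 0.
Proof. by rewrite /enorm linear0l sqrtr0. Qed.

Lemma enorm_gt0 v : v != 0 -> 0 < enorm v.
Proof. by move=> v0; rewrite sqrtr_gt0 inner_gt0. Qed.

Lemma enormZ a v : enorm (a *: v) = `|a| * enorm v.
Proof.
rewrite /enorm innerZl innerZr /= mulrA -expr2 sqrtrM ?sqr_ge0//.
by rewrite sqrtr_sqr.
Qed.

Lemma enormN v : enorm (- v) = enorm v.
Proof. by rewrite -scaleN1r enormZ normrN1 mul1r. Qed.

Lemma innerD u v : inner (u + v) (u + v) = inner u u + 2 * inner u v + inner v v.
Proof.
rewrite linearDl !linearDr /= (innerC v u); lra.
Qed.

(** Expanding [inner w w >= 0] for [w = |v| u - |u| v] gives the inequality
    multiplied by [2 |u| |v|]. *)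
Lemma cauchy_schwarz u v : inner u v <= enorm u * enorm v.
Proof.
have [->|v0] := eqVneq v 0; first by rewrite linear0r enorm0 mulr0.
have := inner_ge0 (enorm v *: u - enorm u *: v).
rewrite -scaleNr innerD !innerZl !innerZr /= -!enormK.
set a := enorm u; set b := enorm v => h.
have b0 : 0 < b by rewrite enorm_gt0.
have [a0|a0] := eqVneq u 0.
  by rewrite a0 linear0l mulr_ge0// enorm_ge0.
have {}a0 : 0 < a by rewrite enorm_gt0.
have ab : 0 < a * b by rewrite mulr_gt0.
rewrite -(ler_pM2l ab). nra.
Qed.

Lemma enormD u v : enorm (u + v) <= enorm u + enorm v.
Proof.
rewrite -(@ler_pXn2r _ 2)// ?nnegrE ?addr_ge0 ?enorm_ge0//.
rewrite enormK innerD -!enormK; have := cauchy_schwarz u v; nra.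
Qed.

Lemma enormB u v : enorm (u - v) = enorm (v - u).
Proof. by rewrite -enormN opprB. Qed.

Lemma edistC x y : edist x y = edist y x.
Proof. exact: enormB. Qed.

Lemma edistxx x : edist x x = 0.
Proof. by rewrite edistE subrr enorm0. Qed.

Lemma edist_triangle z x y : edist x y <= edist x z + edist z y.
Proof. by rewrite !edistE -[x - y](subrKA z) enormD. Qed.

Lemma norm_le_enorm v : `|v| <= enorm v.
Proof.
rewrite /Num.norm /= mx_normrE; apply/bigmax_leP; split => [|[i j] _ /=].
  exact: enorm_ge0.
rewrite ord1 -(@ler_pXn2r _ 2)// ?nnegrE ?enorm_ge0//.
rewrite enormK real_normK ?num_real// /inner (bigD1 j)//= -expr2 lerDl.
by apply: sumr_ge0 => k _; rewrite -expr2 sqr_ge0.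
Qed.

Lemma coord_le_norm v i : `|v 0 i| <= `|v|.
Proof.
rewrite [leRHS]/Num.norm /= mx_normrE.
exact: (le_bigmax _ (fun ij : 'I_1 * 'I_n => `|v ij.1 ij.2|) (0, i)).
Qed.

Lemma enorm_sum I (s : seq I) (f : I -> 'rV[R]_n) :
  enorm (\sum_(i <- s) f i) <= \sum_(i <- s) enorm (f i).
Proof.
elim: s => [|i s ih]; first by rewrite !big_nil enorm0.
by rewrite !big_cons (le_trans (enormD _ _))// lerD2l.
Qed.

(** The images of the canonical basis bound a linear map from the sup norm to
    the Euclidean norm; the identity then compares the two norms, and the bound
    [1 <= K] makes [K] usable as a divisor. *)
Lemma linear_enorm_le_norm (f : {linear 'rV[R]_n -> 'rV[R]_n}) :
  exists2 K, 1 <= K & forall v, enorm (f v) <= K * `|v|.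
Proof.
exists (1 + \sum_(i < n) enorm (f 'e_i)).
  by rewrite lerDl sumr_ge0// => i _; exact: enorm_ge0.
move=> v; rewrite [in leLHS](row_sum_delta v) linear_sum.
apply: (le_trans (enorm_sum _ _)); rewrite mulrDl mul1r.
rewrite (@le_trans _ _ (\sum_(i < n) enorm (f 'e_i) * `|v|))//.
  apply: ler_sum => i _; rewrite linearZ enormZ mulrC.
  by rewrite ler_wpM2l ?enorm_ge0// coord_le_norm.
by rewrite mulr_suml lerDr.
Qed.

Lemma enorm_linear_bounded (f : {linear 'rV[R]_n -> 'rV[R]_n}) :
  exists2 K, 1 <= K & forall v, enorm (f v) <= K * enorm v.
Proof.
have [K K1 h] := linear_enorm_le_norm f; exists K => // v.
by rewrite (le_trans (h v))// ler_pM2l ?norm_le_enorm// (lt_le_trans _ K1).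
Qed.

Lemma enorm_le_norm : exists2 K, 1 <= K & forall v, enorm v <= K * `|v|.
Proof. exact: (linear_enorm_le_norm idfun). Qed.

(** The topology comes from the sup norm, whereas all metric notions are
    Euclidean; this is the bridge between them. *)
Lemma nbhs_edistP z (A : set 'rV[R]_n) :
  nbhs z A <-> exists2 d, 0 < d & forall x, edist z x < d -> A x.
Proof.
split.
  move=> /nbhs_ballP[d /= d0 dA]; exists d => // x xd; apply: dA.
  by rewrite -ball_normE /=; exact: le_lt_trans (norm_le_enorm _) xd.
move=> [d d0 dA]; have [K K1 KE] := enorm_le_norm.
have K0 : 0 < K by rewrite (lt_le_trans _ K1).
apply/nbhs_ballP; exists (d / K); first by rewrite /= divr_gt0.
move=> x; rewrite -ball_normE /= => zx; apply: dA.
rewrite (le_lt_trans (KE _))// mulrC -ltr_pdivlMr//.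
Qed.

Definition open_eball z (r : R) : set 'rV[R]_n := [set y | edist z y < r].

Lemma open_open_eball z r : open (open_eball z r).
Proof.
rewrite openE => y /= zy; apply/nbhs_edistP; exists (r - edist z y).
  by rewrite subr_gt0.
move=> x yx; rewrite /open_eball /= (le_lt_trans (edist_triangle y _ _))//.
by rewrite addrC -ltrBrDr.
Qed.

Lemma bounded_enormP (A : set 'rV[R]_n) :
  bounded_set A <-> exists M, forall x, A x -> enorm x <= M.
Proof.
split.
  move=> [M [_ hM]]; have [K K1 KE] := enorm_le_norm.
  exists (K * (M + 1)) => x Ax; rewrite (le_trans (KE _))// ler_pM2l//.
    by apply: hM => //; rewrite ltrDl.
  by rewrite (lt_le_trans _ K1).
move=> [M hM]; exists M; split; first exact: num_real.
by move=> N MN x Ax; apply: le_trans (norm_le_enorm _) (le_trans (hM _ Ax) (ltW MN)).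
Qed.

End euclidean_norm.

(** * Packings and Assouad exponents *)

Section packing.
Context {R : realType} {n : nat}.
Implicit Types (A B F : set 'rV[R]_n) (x y z : 'rV[R]_n) (r b : R).

Definition separated r (s : seq 'rV[R]_n) : bool :=
  pairwise (fun x y => r < edist x y) s.

(** Packing numbers replace covering numbers throughout: a packing is a finite
    list of points, so it can be transported by an arbitrary map between the
    points, whereas a cover by sets of prescribed diameter cannot. *)
Definition packing_le A r b : Prop :=
  forall s, separated r s -> (forall x, x \in s -> A x) -> (size s)%:R <= b.

Lemma packing_leW A r b b' : b <= b' -> packing_le A r b -> packing_le A r b'.
Proof. by move=> bb hA s ss sA; apply: le_trans bb; exact: hA. Qed.

(** Each point of a packing of [A] is charged to a piece that contains it. *)
Lemma packing_le_cover (I : eqType) (t : seq I) (B : I -> set 'rV[R]_n)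
    (b : I -> R) A r :
  (forall i, i \in t -> packing_le (B i) r (b i)) ->
  (forall x, A x -> exists2 i, i \in t & B i x) ->
  packing_le A r (\sum_(i <- t) b i).
Proof.
elim: t A => [|i t ih] A hB hA s ss sA.
  case: s sA {ss} => [|x s] sA; first by rewrite big_nil.
  by have [] := hA x (sA x (mem_head _ _)).
rewrite big_cons -(count_predC [pred x | `[< B i x >]]) natrD -!size_filter.
apply: lerD.
  apply: (hB i (mem_head _ _)); first exact: pairwise_filter.
  by move=> x; rewrite mem_filter => /andP[/asboolP].
apply: (ih [set x | A x /\ ~ B i x]).
- by move=> j jt; apply: hB; rewrite inE jt orbT.
- move=> x [Ax nBx]; have [j] := hA x Ax.
  by rewrite inE => /predU1P[->//|jt Bx]; exists j.
- exact: pairwise_filter.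
- by move=> x; rewrite mem_filter => /andP[/asboolPn ? /sA].
Qed.

Lemma packing_le1 A r :
  (forall x y, A x -> A y -> edist x y <= r) -> packing_le A r 1.
Proof.
move=> hA [|x [|y s]]; [by rewrite ler01|by []|].
rewrite /separated /= => /andP[/andP[rxy _] _] sA.
have := hA x y (sA _ _) (sA _ _); rewrite !inE !eqxx ?orbT => /(_ isT isT).
by rewrite leNgt rxy.
Qed.

(** A separated list of maximal length is an [r]-net of [A]. *)
Lemma maximal_separated A r b : packing_le A r b ->
  exists s, [/\ separated r s, forall x, x \in s -> A x &
    forall y, A y -> exists2 x, x \in s & edist x y <= r].
Proof.
move=> hA.
pose Q k := `[< exists s, [/\ separated r s, forall x, x \in s -> A x & size s = k] >].
have Q0 : exists k, Q k by exists 0%N; apply/asboolP; exists [::].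
have Qb k : Q k -> (k <= Num.truncn b)%N.
  move=> /asboolP[s [ss sA <-]]; have sb := hA s ss sA.
  by rewrite truncn_ge_nat// (le_trans _ sb).
case: (ex_maxnP Q0 Qb) => k /asboolP[s [ss sA sk]] kmax.
exists s; split => // y Ay; apply: contrapT => hy.
have /kmax : Q k.+1; last by rewrite ltnn.
apply/asboolP; exists (y :: s); rewrite /= sk; split => //; last first.
  by move=> x; rewrite inE => /predU1P[->|/sA].
rewrite /separated /= [pairwise _ s]ss andbT; apply/allP => x xs.
by rewrite ltNge; apply/negP => yx; apply: hy; exists x; rewrite // edistC.
Qed.

Lemma edist_le_diam A x y : A x -> A y -> ((edist x y)%:E <= diam A)%E.
Proof. by move=> Ax Ay; apply: ereal_sup_ubound; right; exists (x, y). Qed.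

Lemma diam_ge0 A : (0 <= diam A)%E.
Proof. by apply: ereal_sup_ubound; left. Qed.

Lemma diam_le A r : 0 <= r -> (forall x y, A x -> A y -> edist x y <= r) ->
  (diam A <= r%:E)%E.
Proof.
move=> r0 hA; apply: ge_ereal_sup => _ [->|[[x y] [/= Ax Ay] <-]]; rewrite lee_fin//.
exact: hA.
Qed.

Lemma enorm_delta (i : 'I_n) : enorm ('e_i : 'rV[R]_n) = 1.
Proof.
rewrite /enorm /inner (bigD1 i)//= big1 ?addr0 => [|j ji].
  by rewrite !mxE !eqxx mulr1 sqrtr1.
by rewrite !mxE (negPf ji) andbF mulr0.
Qed.

(** The diameter is attained at [x + r *: e] and [x - r *: e] for a unit vector
    [e], which exists because [0 < n]. *)
Lemma diam_eball x r : (0 < n)%N -> 0 <= r -> diam (eball x r) = (2 * r)%:E.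
Proof.
move=> n0 r0; apply/eqP; rewrite eq_le; apply/andP; split.
  apply: diam_le => [|y z]; rewrite /eball /= ?mulr_ge0// => xy xz.
  apply: (le_trans (edist_triangle x _ _)).
  by rewrite edistC mulr_natl mulr2n lerD.
pose e : 'rV[R]_n := r *: 'e_(Ordinal n0).
have eE : enorm e = r by rewrite enormZ enorm_delta mulr1 ger0_norm.
have -> : 2 * r = edist (x + e) (x - e).
  rewrite edistE opprB addrC addrA subrK -[e + e]mulr2n -(scaler_nat 2 e) enormZ eE.
  by rewrite normr_nat.
apply: edist_le_diam; rewrite /eball /= edistE opprD ?opprK addrA subrr add0r.
  by rewrite enormN eE.
by rewrite eE.
Qed.

(** The [r / 2]-balls around a maximal [r / 2]-separated list have diameter
    exactly [r], as the definition of an Assouad exponent requires. *)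
Lemma cover_of_packing A r b : (0 < n)%N -> 0 < r -> packing_le A (r / 2) b ->
  exists (N : nat) (U : 'I_N -> set 'rV[R]_n), [/\ N%:R <= b,
    forall i, diam (U i) = r%:E & A `<=` \bigcup_i U i].
Proof.
move=> n0 r0 hA; have [s [ss sA sc]] := maximal_separated hA.
exists (size s), (fun i => eball (s`_i) (r / 2)); split.
- exact: hA.
- by move=> i; rewrite diam_eball ?divr_ge0 1?ltW// mulrC divfK.
- move=> y /sc[x xs xy]; have xi : (index x s < size s)%N by rewrite index_mem.
  by exists (Ordinal xi) => //=; rewrite /eball /= nth_index.
Qed.

(** A set of diameter at most [r] contains at most one point of an
    [r]-separated list. *)
Lemma packing_of_cover A r (N : nat) (U : 'I_N -> set 'rV[R]_n) :
  (forall i, (diam (U i) <= r%:E)%E) -> A `<=` \bigcup_i U i ->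
  packing_le A r N%:R.
Proof.
move=> hU AU.
have -> : N%:R = \sum_(i <- enum 'I_N) (1 : R).
  by rewrite big_enum /= sumr_const card_ord.
apply: (packing_le_cover (B := U)) => [i _|x /AU[i _ Ux]].
  apply: packing_le1 => x y Ux Uy; rewrite -lee_fin.
  exact: le_trans (edist_le_diam Ux Uy) (hU i).
by exists i; rewrite // mem_enum.
Qed.

Lemma assouad_exponent_packing F (alpha : R) : assouad_exponent F alpha ->
  exists2 C : R, 0 < C & forall x r rho, F x -> 0 < r -> r < rho ->
    packing_le (F `&` eball x rho) r (C * (rho / r) `^ alpha).
Proof.
move=> [C C0 hC]; exists C => // x r rho Fx r0 rrho.
have [N [U [NC dU FU]]] := hC x r rho Fx r0 rrho.
apply: (packing_leW (ltW NC)); apply: packing_of_cover FU => i.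
by rewrite dU.
Qed.

Lemma packing_assouad_exponent F (alpha C : R) : (0 < n)%N -> 0 <= C ->
  (forall x r rho, F x -> 0 < r -> r < rho ->
    packing_le (F `&` eball x rho) r (C * (rho / r) `^ alpha)) ->
  assouad_exponent F alpha.
Proof.
move=> n0 C0 hC.
have D0 : 0 <= C * 2 `^ alpha by rewrite mulr_ge0// powR_ge0.
exists (C * 2 `^ alpha + 1); first by rewrite ltr_wpDl.
(* Covers at scale r come from packings at scale r / 2, which costs 2^alpha;
   the final + 1 makes the inequality strict. *)
move=> x r rho Fx r0 rrho; have rho0 := lt_trans r0 rrho.
have r2 : r / 2 < rho by lra.
have r20 : 0 < r / 2 by rewrite divr_gt0.
have [N [U [NC dU FU]]] := cover_of_packing n0 r0 (hC x _ _ Fx r20 r2).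
exists N, U; split => //; apply: (le_lt_trans NC).
have -> : rho / (r / 2) = 2 * (rho / r) by rewrite invf_div mulrCA.
have q0 : 0 < rho / r by rewrite divr_gt0.
rewrite powRM ?(ltW q0)// mulrA mulrDl mul1r ltrDl.
exact: powR_gt0.
Qed.

End packing.

(** * Efficient covers *)

Section efficient_covers.
Context {R : realType} {n : nat}.
Implicit Types (F : set 'rV[R]_n) (x : 'rV[R]_n) (r rho t : R) (k : nat).

Lemma powR_ge1 (a t : R) : 0 <= t -> 1 <= a -> 1 <= a `^ t.
Proof.
move=> t0 a1; have := @ge0_ler_powR _ t t0 1 a; rewrite !nnegrE powR1 => -> //.
exact: le_trans a1.
Qed.

Lemma closed_eball x r : closed (eball x r).
Proof.
rewrite -[eball x r]setCK; apply: open_closedC; rewrite openE => y /= /negP.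
rewrite -ltNge => xy; apply/nbhs_edistP; exists (edist x y - r).
  by rewrite subr_gt0.
move=> z yz /=; apply/negP; rewrite -ltNge.
rewrite -(ltrD2r (edist y z)); move: yz; rewrite ltrBrDr addrC => yz.
by rewrite (lt_le_trans yz)// (edistC y z) (edist_triangle z).
Qed.

Lemma bounded_eball x r : bounded_set (eball x r).
Proof.
apply/bounded_enormP; exists (r + enorm x) => y xy.
by rewrite -[y](subrK x) (le_trans (enormD _ _))// lerD2r enormB.
Qed.

Lemma compact_eball x r : compact (eball x r).
Proof. apply: bounded_closed_compact; [exact: bounded_eball|exact: closed_eball]. Qed.

(** Total boundedness, from the compactness of closed balls. *)
Lemma bounded_finite_cover F rho : bounded_set F -> 0 < rho ->
  exists s : seq 'rV[R]_n, forall x, F x -> exists2 c, c \in s & edist c x <= rho.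
Proof.
move=> /bounded_enormP[M FM] rho0.
have := @compact_eball 0 M; rewrite compact_cover.
move=> /(_ _ setT (fun c => open_eball c rho)).
case=> [c _|x _|D _ hD]; first exact: open_open_eball.
  by exists x => //; rewrite /open_eball /= edistxx.
exists (enum_fset D) => x Fx; have [|c cD cx] := hD x.
  by rewrite /eball /= edistE sub0r enormN FM.
by exists c => //; exact: ltW.
Qed.

(** The ratios [p.2] are at most [1 / 2], so that iterating efficient covers
    reaches every scale, and at least [2 ^- k], so that the scale is not
    overshot by more than a constant factor. *)
Definition efficient_cover F t k x rho : Prop :=
  exists s : seq ('rV[R]_n * R), [/\
    forall p, p \in s -> 2 ^- k <= p.2 <= 1 / 2,
    forall y, F y -> edist x y <= rho ->
      exists2 p, p \in s & edist p.1 y <= p.2 * rho &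
    \sum_(p <- s) p.2 `^ t <= 1].

(** Efficient covers are iterated inside one another until the radii are at most
    [r / 2]; there a ball holds at most one point of an [r]-separated list.
    Since [\sum_i th_i ^ t <= 1], the bound [(2 ^ (k + 1) rho / r) ^ t] is
    inherited by a ball from the balls of its cover; and since the ratios are at
    least [2 ^- k], it is at least [1] on the last balls.  The induction is on
    the number of dyadic scales between [r / 2] and [rho]. *)
Lemma efficient_cover_packing F t k rho0 : 0 <= t ->
  (forall x rho, 0 < rho -> rho <= rho0 -> efficient_cover F t k x rho) ->
  forall x r rho, 0 < r -> rho <= rho0 -> 2 ^- k * r <= 2 * rho ->
    packing_le (F `&` eball x rho) r ((2 ^+ k.+1 * (rho / r)) `^ t).
Proof.
move=> t0 heff x r rho r0 rhole lerho.
have k0 : 0 < 2 ^- k :> R by rewrite invr_gt0 exprn_gt0.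
have rho_gt0 : 0 < rho.
  by rewrite -(@pmulr_rgt0 _ 2)//; apply: lt_le_trans lerho; rewrite mulr_gt0.
have [j jle] : exists j : nat, rho <= 2 ^+ j * (r / 2).
  have r20 : 0 < r / 2 by rewrite divr_gt0.
  exists (Num.truncn (rho / (r / 2))).+1; rewrite -ler_pdivrMr//.
  apply: (le_trans (ltW (truncnS_gt _))).
  by rewrite -natrX ler_nat ltnW// ltn_expl.
elim: j x rho rhole lerho rho_gt0 jle => [|j ih] x rho rhole lerho rho_gt0 jle.
  apply: (@packing_leW _ _ _ _ 1); last first.
    apply: packing_le1 => y z [_ /= xy] [_ /= xz].
    apply: (le_trans (edist_triangle x _ _)); rewrite edistC.
    move: xy xz jle; rewrite /eball /= expr0; lra.
  apply: powR_ge1 => //; rewrite exprS mulrAC mulrC -ler_pdivrMl ?exprn_gt0// mulr1.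
  by rewrite mulrA ler_pdivlMr.
have [small|large] := leP rho (r / 2).
  apply: ih => //; rewrite (le_trans small)// ler_peMl ?divr_ge0 ?(ltW r0)//.
  by rewrite exprn_ege1// ler1n.
have [s [sb sc ssum]] := heff x rho rho_gt0 rhole.
apply: (@packing_leW _ _ _ _ (\sum_(p <- s) (2 ^+ k.+1 * ((p.2 * rho) / r)) `^ t)).
  have -> : \sum_(p <- s) (2 ^+ k.+1 * (p.2 * rho / r)) `^ t =
      (\sum_(p <- s) p.2 `^ t) * (2 ^+ k.+1 * (rho / r)) `^ t.
    rewrite mulr_suml big_seq [RHS]big_seq; apply: eq_bigr => p /sb/andP[p0 _].
    rewrite -powRM.
    - by congr (_ `^ t); rewrite -!mulrA mulrCA.
    - by rewrite (le_trans _ p0)// ltW.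
    - by rewrite mulr_ge0 ?exprn_ge0// divr_ge0// ltW.
  by rewrite ler_piMl// powR_ge0.
apply: (packing_le_cover (B := fun p => F `&` eball p.1 (p.2 * rho))).
  move=> p /sb/andP[p1 p2]; have p0 := lt_le_trans k0 p1.
  apply: ih; rewrite ?mulr_gt0//.
  - apply: le_trans rhole; rewrite ler_piMl ?ltW// (le_lt_trans p2)//; lra.
  - rewrite (@le_trans _ _ (2 ^- k * (2 * rho)))//.
      by rewrite ler_pM2l//; lra.
    by rewrite mulrCA ler_pM2l// ler_pM2r.
  - rewrite (@le_trans _ _ (1 / 2 * rho))// ?ler_pM2r//.
    by move: jle; rewrite exprS -mulrA; lra.
by move=> y [Fy xy]; have [p ps py] := sc y Fy xy; exists p.
Qed.

(** Only small balls are assumed to have efficient covers: since [F] is bounded,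
    finitely many balls of radius [rho0] take care of the larger scales. *)
Lemma efficient_cover_exponent F t k rho0 : (0 < n)%N -> bounded_set F ->
  0 <= t -> 0 < rho0 ->
  (forall x rho, 0 < rho -> rho <= rho0 -> efficient_cover F t k x rho) ->
  assouad_exponent F t.
Proof.
move=> n0 Fb t0 rho00 heff; have [s sF] := bounded_finite_cover Fb rho00.
apply: (packing_assouad_exponent
  (C := ((size s)%:R + 1) * (2 ^+ k.+1) `^ t)) => //.
(* b bounds the packings of every ball of radius at most rho0; it is at least 1
   because r < rho. *)
move=> x r rho Fx r0 rrho; have rho_gt0 := lt_trans r0 rrho.
have q0 : 0 <= rho / r by rewrite divr_ge0 ?ltW.
rewrite -mulrA -powRM ?exprn_ge0//; set b := _ `^ t.
have b1 : 1 <= b.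
  apply: powR_ge1 => //.
  rewrite -[leLHS](mulr1 1) ler_pM// ?exprn_ege1 ?ler1n// ler_pdivlMr ?mul1r//.
  exact: ltW.
have k1 : 2 ^- k <= 1 :> R by rewrite invf_le1 ?exprn_gt0// exprn_ege1 ?ler1n.
have [small|large] := leP rho rho0.
  apply: (packing_leW _ (efficient_cover_packing t0 heff (x := x) r0 small _)).
    by rewrite ler_peMl ?(le_trans _ b1)// lerDr.
  rewrite (@le_trans _ _ (1 * r))// ?ler_pM2r//; lra.
apply: (@packing_leW _ _ _ _ (\sum_(c <- s) b)).
  rewrite big_const_seq count_predT iter_addr addr0 -[b *+ _]mulr_natl.
  by rewrite ler_pM2r ?(lt_le_trans _ b1)// lerDl.
apply: (packing_le_cover (B := fun c => F `&` eball c rho0)) => [c cs|y [Fy _]].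
  have [h|h] := leP (2 ^- k * r) (2 * rho0).
    apply: (packing_leW _ (efficient_cover_packing t0 heff (x := c) r0 (lexx _) h)).
    have q00 : 0 <= rho0 / r by rewrite divr_ge0 ?ltW.
    have pow0 : 0 <= 2 ^+ k.+1 :> R by rewrite exprn_ge0.
    rewrite /b; apply: ge0_ler_powR => //; rewrite ?nnegrE; [exact: mulr_ge0..|].
    by rewrite ler_pM2l ?exprn_gt0// ler_pM2r ?invr_gt0// ltW.
  apply: (packing_leW b1); apply: packing_le1 => y z [_ /= xy] [_ /= xz].
  apply: (le_trans (edist_triangle c _ _)); rewrite edistC.
  have : 2 ^- k * r <= 1 * r by rewrite ler_pM2r.
  move: xy xz h; rewrite /eball /=; lra.
by have [c cs cy] := sF y Fy; exists c.
Qed.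

End efficient_covers.

(** * Weak tangents *)

Lemma compact_ultra_cvg (I : Type) (T : topologicalType) (U : set_system I)
    (A : set T) (f : I -> T) : UltraFilter U -> compact A ->
  (\forall k \near U, A (f k)) -> exists2 p, A p & f @ U --> p.
Proof.
move=> UU cA UA; have [p [Ap clp]] := cA _ (fmap_proper_filter f _) UA.
exists p => // B pB; have [//|nB] := in_ultra_setVsetC (f @^-1` B) UU.
by have [q []] := clp (~` B) B nB pB.
Qed.

Section tangents.
Context {R : realType} {n : nat}.
Variables (F : set 'rV[R]_n) (U : set_system nat) (UU : UltraFilter U).
Variables (x : nat -> 'rV[R]_n) (rho : nat -> R).

Definition blowup (k : nat) : set 'rV[R]_n :=
  [set f | enorm f <= 1 /\ F (x k + rho k *: f)].

(** The limit of the blow-ups along [U], for the Hausdorff distance. *)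
Definition weak_tangent : set 'rV[R]_n :=
  [set e | forall eps, 0 < eps ->
    \forall k \near U, exists2 f, blowup k f & edist e f < eps].

Lemma weak_tangent_enorm e : weak_tangent e -> enorm e <= 1.
Proof.
move=> Te; rewrite leNgt; apply/negP => e1.
have e10 : 0 < enorm e - 1 by rewrite subr_gt0.
have [k [f [f1 _]]] := filter_ex (Te _ e10).
have := enormD (e - f) f; rewrite subrK edistE; lra.
Qed.

Lemma closed_weak_tangent : closed weak_tangent.
Proof.
rewrite -[weak_tangent]setCK; apply: open_closedC; rewrite openE => e nTe.
have [eps eps0 neps] : exists2 eps, 0 < eps &
    ~ \forall k \near U, exists2 f, blowup k f & edist e f < eps.
  apply: contrapT => h; apply: nTe => eps eps0.
  by apply: contrapT => ?; apply: h; exists eps.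
have eps20 : 0 < eps / 2 by rewrite divr_gt0.
apply/nbhs_edistP; exists (eps / 2) => // e' ee' /(_ _ eps20) Te'; apply: neps.
apply: filterS Te' => k [f fk e'f]; exists f => //.
have := edist_triangle e' e f; lra.
Qed.

Lemma compact_weak_tangent : compact weak_tangent.
Proof.
apply: (subclosed_compact closed_weak_tangent (@compact_eball R n 0 1)) => e.
by move=> /weak_tangent_enorm; rewrite /eball /= edistE sub0r enormN.
Qed.

(** If the blow-ups left [O] for [U]-many [k], points of the blow-ups outside
    [O] would converge along [U], by compactness of the unit ball, to a point of
    the weak tangent outside [O]. *)
Lemma blowup_sub_nbhs (O : set 'rV[R]_n) : open O -> weak_tangent `<=` O ->
  \forall k \near U, blowup k `<=` O.
Proof.
move=> oO TO; have [//|nU] := in_ultra_setVsetC [set k | blowup k `<=` O] UU.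
have /choice[f hf] : forall k, exists f, ~ (blowup k `<=` O) ->
    blowup k f /\ ~ O f.
  move=> k; have [h|h] := pselect (blowup k `<=` O); first by exists 0.
  apply: contrapT => h'; apply: h => f fk; apply: contrapT => fO.
  by apply: h'; exists f.
have fU : \forall k \near U, blowup k (f k) /\ ~ O (f k).
  by apply: filterS nU => k /hf.
have [|p _ fp] := compact_ultra_cvg (f := f) UU (@compact_eball R n 0 1).
  by apply: filterS fU => k [[fk _] _]; rewrite /eball /= edistE sub0r enormN.
have Op : O p.
  apply: TO => eps eps0; have : nbhs p (open_eball p eps).
    by apply/nbhs_edistP; exists eps.
  move=> /fp pU; apply: filterS2 fU pU => k [fk _] /= pfk.
  by exists (f k).
have /fp OU : nbhs p O by exact: open_nbhs_nbhs.
by have [k [/= [_ ?] ?]] := filter_ex (filterI fU OU).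
Qed.

End tangents.

(** * Lower bound for the Hausdorff measure of a weak tangent *)

Section tangent_content.
Context {R : realType}.

Lemma sum_uniq_le (f : nat -> R) (s : seq nat) (N : nat) : uniq s ->
  (forall i, 0 <= f i) -> (forall i, i \in s -> (i < N)%N) ->
  \sum_(i <- s) f i <= \sum_(0 <= i < N) f i.
Proof.
move=> us f0 sN.
have -> : \sum_(i <- s) f i = \sum_(0 <= i < N | i \in s) f i.
  rewrite -[RHS]big_filter; apply: perm_big; apply: uniq_perm => //.
    by rewrite filter_uniq// iota_uniq.
  move=> i; rewrite mem_filter mem_index_iota /=.
  by case: (boolP (i \in s)) => // /sN ->.
rewrite big_mkcond; apply: ler_sum => i _; by case: ifP.
Qed.

Lemma geometric_half (N : nat) : \sum_(0 <= i < N) 2 ^- i.+2 <= 1 / 2 :> R.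
Proof.
suff -> : \sum_(0 <= i < N) 2 ^- i.+2 = 1 / 2 - 2 ^- N.+1 :> R.
  by rewrite gerBl invr_ge0 exprn_ge0.
elim: N => [|N ih]; first by rewrite big_nil expr1 mul1r subrr.
have a0 : 2 ^+ N != 0 :> R by rewrite expf_neq0.
by rewrite big_nat_recr//= ih !exprS; field.
Qed.

Lemma near_expVn_le (a : R) : 0 < a -> \forall k \near \oo, 2 ^- k <= a.
Proof.
move=> a0; near=> k; apply: (@le_trans _ _ k.+1%:R^-1).
  rewrite lef_pV2 ?posrE ?exprn_gt0// -natrX ler_nat.
  exact: ltn_expl.
by apply: ltW; near: k; exact: near_infty_natSinv_lt (PosNum a0).
Unshelve. all: by end_near. Qed.

Lemma small_powR (b t e : R) : 0 < b -> 0 < t -> 0 < e ->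
  exists z, [/\ 0 < z, z <= b & z `^ t <= e].
Proof.
move=> b0 t0 e0; exists (Num.min b (e `^ t^-1)); split.
- by rewrite lt_min powR_gt0// andbT.
- by rewrite ge_min lexx.
- apply: (@le_trans _ _ ((e `^ t^-1) `^ t)); last first.
    by rewrite -powRrM mulVf ?gt_eqF// powRr1// ltW.
  apply: ge0_ler_powR; rewrite ?nnegrE ?powR_ge0//; first exact: ltW.
    by rewrite le_min powR_ge0 andbT ltW.
  by rewrite ge_min lexx orbT.
Qed.

Context {n : nat}.
Implicit Types (F : set 'rV[R]_n) (t : R).

(** The ratios of an efficient cover are at most [1], so their powers decrease
    with the exponent. *)
Lemma efficient_coverW F t t' k x rho : t <= t' ->
  efficient_cover F t k x rho -> efficient_cover F t' k x rho.
Proof.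
move=> tt' [s [sb sc ssum]]; exists s; split => //; apply: le_trans ssum.
rewrite big_seq [leRHS]big_seq; apply: ler_sum => p /sb/andP[p0 p1].
apply: ger_powR => //; rewrite (lt_le_trans _ p0) ?invr_gt0 ?exprn_gt0//=.
lra.
Qed.

Variables (F : set 'rV[R]_n) (U : set_system nat) (UU : UltraFilter U).
Variables (x : nat -> 'rV[R]_n) (rho : nat -> R).
Hypothesis rho_gt0 : forall k, 0 < rho k.
Hypothesis U_oo : \oo `<=` U.

(** If the measure vanished, there would be a cover [V] of the weak tangent with
    [\sum_i (diam V_i)^t] small.  Each [V_i] lies in an open ball of radius
    [th i] slightly larger than its diameter; finitely many of these balls cover
    the weak tangent, hence also the blow-ups for [U]-many [k], and rescaling
    them gives an efficient cover in dimension [t'].  The strict inequality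
    [t < t'] ensures [0 < t'], so that pieces of diameter [0] can be thickened
    at a small cost even when [t = 0]. *)
Lemma weak_tangent_measure_neq0 t t' : 0 <= t -> t < t' ->
  (\forall k \near U, ~ efficient_cover F t' k (x k) (rho k)) ->
  hausdorff_measure t (weak_tangent F U x rho) <> 0%E.
Proof.
move=> t0 tt' neff H0; have t'0 := le_lt_trans t0 tt'.
set E := weak_tangent F U x rho in H0.
have e0 : 0 < (2 `^ t)^-1 / 2 :> R by rewrite divr_gt0// invr_gt0 powR_gt0.
have : (hausdorff_premeasure t (1 / 4) E < ((2 `^ t)^-1 / 2)%:E)%E.
  apply: (@le_lt_trans _ _ 0%E); last by rewrite lte_fin.
  by rewrite -H0; apply: ereal_sup_ubound; exists (1 / 4) => //=; rewrite divr_gt0.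
move=> /ereal_inf_lt[_ [V [EV dV] <-] Vsum].
pose d i := fine (diam (V i)).
have dE i : diam (V i) = (d i)%:E.
  rewrite /d fineK// ge0_fin_numE ?diam_ge0//.
  by rewrite (le_lt_trans (dV i))// ltry.
have d0 i : 0 <= d i by rewrite -lee_fin -dE diam_ge0.
have d4 i : d i <= 1 / 4 by rewrite -lee_fin -dE.
have /choice[z hz] : forall i : nat,
    exists z, [/\ 0 < z, z <= 1 / 2 & z `^ t' <= 2 ^- i.+2].
  by move=> i; apply: small_powR; rewrite ?divr_gt0// invr_gt0 exprn_gt0.
(* Doubling d i makes room for an open ball, at the price of a factor 2^t;
   z i handles the pieces of diameter 0, at a total cost of at most 1/2. *)
pose th i := Num.max (2 * d i) (z i).
have thz i : z i <= th i by rewrite le_max lexx orbT.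
have th0 i : 0 < th i by have [z0 _ _] := hz i; exact: lt_le_trans (thz i).
have th2 i : th i <= 1 / 2.
  by have [_ z2 _] := hz i; rewrite ge_max z2 andbT; have := d4 i; lra.
have dth i : d i < th i.
  rewrite lt_max; have [z0 _ _] := hz i.
  by have := d0 i; rewrite le0r => /predU1P[->|dp]; [rewrite z0 orbT|apply/orP; left; lra].
have thpow i : th i `^ t' <= 2 `^ t * d i `^ t + 2 ^- i.+2.
  have [z0 z2 ze] := hz i.
  have [h|h] := leP (2 * d i) (z i).
    rewrite /th max_r//; apply: (le_trans ze); rewrite lerDr.
    by rewrite mulr_ge0 ?powR_ge0.
  rewrite /th max_l; last exact: ltW.
  rewrite -(powRM _ (ler0n _ 2) (d0 i)).
  apply: (@le_trans _ _ ((2 * d i) `^ t)); last by rewrite lerDl invr_ge0 exprn_ge0.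
  apply: ger_powR; last exact: ltW.
  by rewrite (lt_trans z0 h)/=; have := d4 i; lra.
(* The empty pieces, which have no center, are left out. *)
have /choice[c hc] : forall i, exists c, V i !=set0 -> V i c.
  move=> i; have [[c ?]|h] := pselect (V i !=set0); first by exists c.
  by exists 0.
have := @compact_weak_tangent _ _ F U UU x rho; rewrite compact_cover.
move=> /(_ _ [set i | V i !=set0] (fun i => open_eball (c i) (th i))).
case=> [i _|e /EV[i _ Ve]|D DV ED]; first exact: open_open_eball.
  exists i; first by exists e.
  rewrite /open_eball /= (le_lt_trans _ (dth i))// -lee_fin -dE.
  by apply: edist_le_diam => //; apply: hc; exists e.
pose O := \bigcup_(i in [set` D]) open_eball (c i) (th i).
have oO : open O by apply: bigcup_open => i _; exact: open_open_eball.
have kO := blowup_sub_nbhs UU oO ED.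
have kth : U (\bigcap_(i in [set` D]) [set k | 2 ^- k <= th i]).
  by apply: filter_bigI => i _; apply: U_oo; exact: near_expVn_le.
have [k [[nk kE] kD]] := filter_ex (filterI (filterI neff kO) kth).
apply: nk; exists [seq (x k + rho k *: c i, th i) | i <- enum_fset D]; split.
- by move=> p /mapP[i iD ->] /=; rewrite th2 andbT; apply: kD.
- move=> y Fy xy; pose f := (rho k)^-1 *: (y - x k).
  have yE : y = x k + rho k *: f.
    by rewrite /f scalerA mulfV ?gt_eqF// scale1r addrC subrK.
  have [i iD ci] : O f.
    apply: kE; split; last by rewrite -yE.
    rewrite enormZ gtr0_norm ?invr_gt0// ler_pdivrMl// mulr1.
    by rewrite enormB.
  exists (x k + rho k *: c i, th i); first by apply/mapP; exists i.
  rewrite /= edistE [in leLHS]yE opprD addrACA subrr add0r -scalerBr enormZ.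
  by rewrite gtr0_norm// mulrC ler_pM2r// ltW.
rewrite big_map /=.
have Dnat : exists N, forall i, i \in enum_fset D -> (i < N)%N.
  exists (\max_(i <- enum_fset D) i).+1 => i iD; rewrite ltnS.
  by rewrite (big_rem i)//= leq_maxl.
have [N DN] := Dnat.
have sumd : \sum_(i <- enum_fset D) d i `^ t <= (2 `^ t)^-1 / 2.
  rewrite -lee_fin; apply: le_trans (ltW Vsum).
  apply: (@le_trans _ _ (\sum_(0 <= i < N) hausdorff_cost t (V i))%E); last first.
    apply: nneseries_lim_ge => i _ _; rewrite /hausdorff_cost.
    by case: ifP => // _; exact: poweR_ge0.
  pose f i := fine (hausdorff_cost t (V i)).
  have fE i : hausdorff_cost t (V i) = (f i)%:E.
    by rewrite /f /hausdorff_cost; case: ifP => // _; rewrite dE poweR_EFin.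
  under [leRHS]eq_bigr do rewrite fE.
  rewrite sumEFin lee_fin.
  rewrite (@le_trans _ _ (\sum_(i <- enum_fset D) f i))//.
    rewrite big_seq [leRHS]big_seq; apply: ler_sum => i iD.
    rewrite -lee_fin -fE /hausdorff_cost; case: eqP => [V0|_].
      by have := set_mem (DV i iD); rewrite /= V0 => -[].
    by rewrite dE poweR_EFin.
  apply: sum_uniq_le => //; first exact: fset_uniq.
  by move=> i; rewrite -lee_fin -fE /hausdorff_cost; case: ifP => // _; exact: poweR_ge0.
have sumz : \sum_(i <- enum_fset D) 2 ^- i.+2 <= 1 / 2 :> R.
  apply: le_trans (geometric_half N); apply: sum_uniq_le => //.
  exact: fset_uniq.
apply: (@le_trans _ _ (\sum_(i <- enum_fset D) (2 `^ t * d i `^ t + 2 ^- i.+2))).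
  by apply: ler_sum => i _.
rewrite big_split /= -mulr_sumr.
apply: (@le_trans _ _ (1 / 2 + 1 / 2)); last lra.
apply: lerD => //; by rewrite -ler_pdivlMl ?powR_gt0// mul1r.
Qed.

End tangent_content.

(** * Tangents and differentiable maps *)

Section transfer.
Context {R : realType} {n : nat}.

Lemma near_seq (I : Type) (T : eqType) (U : set_system I) (P : T -> I -> Prop)
    (l : seq T) : Filter U ->
  (forall e, e \in l -> \forall k \near U, P e k) ->
  \forall k \near U, forall e, e \in l -> P e k.
Proof.
move=> FU; elim: l => [_|a l ih hl]; first exact: nearW.
have ha := hl a (mem_head _ _).
have {}ih : \forall k \near U, forall e, e \in l -> P e k.
  by apply: ih => e el; apply: hl; rewrite inE el orbT.
by apply: filterS2 ha ih => k ha hk e; rewrite inE => /predU1P[->|/hk].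
Qed.

Lemma packing_le_map (B : set 'rV[R]_n) (r r' b : R) (s : seq 'rV[R]_n)
    (g : 'rV[R]_n -> 'rV[R]_n) : separated r s ->
  {in s &, forall v w, r < edist v w -> r' < edist (g v) (g w)} ->
  {in s, forall v, B (g v)} -> packing_le B r' b -> (size s)%:R <= b.
Proof.
move=> ss sg sB hB; rewrite -(size_map g); apply: hB.
  rewrite /separated pairwise_map.
  by apply: (sub_in_pairwise (P := mem s)) ss => //; exact/allP.
by move=> _ /mapP[v vs ->]; exact: sB.
Qed.

(** Stronger than differentiability at [z]: the linear approximation is uniform
    over pairs of points near [z], as needed for points [x k + rho k *: e] whose
    base point [x k] is not [z]. *)
Definition strictly_differentiable (f L : 'rV[R]_n -> 'rV[R]_n) (z : 'rV[R]_n) :=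
  forall eps, 0 < eps -> exists2 d, 0 < d & forall u v,
    edist z u < d -> edist z v < d ->
    enorm (f u - f v - L (u - v)) <= eps * enorm (u - v).

Variables (F : set 'rV[R]_n) (U : set_system nat) (UU : UltraFilter U).
Variables (x : nat -> 'rV[R]_n) (rho : nat -> R) (z : 'rV[R]_n).
Hypothesis rho_gt0 : forall k, 0 < rho k.
Hypothesis rho_cvg0 : forall eps, 0 < eps -> \forall k \near U, rho k < eps.
Hypothesis x_cvg : forall eps, 0 < eps -> \forall k \near U, edist z (x k) < eps.

(** Take an [r]-separated list in a ball of radius [r1] of [p @` E].  Its points
    are [p e] with [e] in [E], and [e] is approximated by a point [psi e] of the
    blow-up of index [k].  The points [G e = f (x k + rho k *: psi e)] of
    [f @` F] satisfy [G e - G e' = rho k *: L (e - e')] up to a small multiple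
    of [rho k * r]; as [|L v|] and [|p v|] are comparable, they are separated by
    a multiple of [rho k * r] and lie in a ball of radius a multiple of
    [rho k * r1].  The factor [rho k] cancels in the ratio of the two scales.
    With [f], [L] and [p] all equal to the identity this says that [F] passes
    its exponents on to its weak tangents. *)
Lemma assouad_exponent_weak_tangent (f : 'rV[R]_n -> 'rV[R]_n)
    (L p : {linear 'rV[R]_n -> 'rV[R]_n}) (K alpha : R) : (0 < n)%N ->
  strictly_differentiable f L z -> 1 <= K ->
  (forall v, enorm (p v) <= K * enorm (L v)) ->
  (forall v, enorm (L v) <= K * enorm (p v)) ->
  assouad_exponent (f @` F) alpha ->
  assouad_exponent (p @` weak_tangent F U x rho) alpha.
Proof.
move=> n0 fL K1 pL Lp /assouad_exponent_packing[C C0 hC].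
have K0 : 0 < K by apply: lt_le_trans K1.
have [M M1 LM] := enorm_linear_bounded L.
have M0 : 0 < M by apply: lt_le_trans M1.
set E := weak_tangent F U x rho.
apply: (packing_assouad_exponent (C := C * (4 * (K * K)) `^ alpha)) => //.
  by rewrite mulr_ge0 ?powR_ge0// ltW.
move=> _ r r1 [e0 Ee0 <-] r0 rr1 s ss sA; have r10 := lt_trans r0 rr1.
have /choice[phi hphi] : forall w, exists e, w \in s -> E e /\ p e = w.
  move=> w; have [ws|nws] := boolP (w \in s); last by exists 0.
  by have [[e Ee <-] _] := sA w ws; exists e.
have sball w : w \in s -> enorm (p e0 - w) <= r1 by move=> /sA[].
(* L separates the points e by r / K = 8 q; the approximation errors are at most
   4 q, so the images stay separated by 4 q, in units of rho k. *)
pose q := r / (8 * K).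
have q0 : 0 < q by rewrite divr_gt0// mulr_gt0.
have qE : r = 8 * K * q by rewrite /q mulrC divfK// gt_eqF// mulr_gt0.
have [d d0 hd] := fL q q0.
have near_pt : \forall k \near U, forall e, e \in e0 :: map phi s ->
    exists2 g, blowup F x rho k g & edist e g < q / M.
  apply: near_seq => e; rewrite inE => eh; have Ee : E e.
    by case/predU1P: eh => [->//|/mapP[w ws ->]]; have [] := hphi w ws.
  by apply: Ee; rewrite divr_gt0.
have d20 : 0 < d / 2 by rewrite divr_gt0.
have [k [[kpt kx] krho]] :=
  filter_ex (filterI (filterI near_pt (x_cvg d20)) (rho_cvg0 d20)).
have /choice[psi hpsi] : forall e, exists g, e \in e0 :: map phi s ->
    blowup F x rho k g /\ edist e g < q / M.
  move=> e; have [es|nes] := boolP (e \in e0 :: map phi s); last by exists 0.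
  by have [g] := kpt e es; exists g.
pose G e := f (x k + rho k *: psi e).
have Gdiff e e' : e \in e0 :: map phi s -> e' \in e0 :: map phi s ->
    enorm (G e - G e' - rho k *: L (e - e')) <= rho k * (4 * q).
  move=> es es'; have [[g1 gF] eg] := hpsi e es.
  have [[g1' gF'] eg'] := hpsi e' es'.
  have bd h : enorm h <= 1 -> edist z (x k + rho k *: h) < d.
    move=> h1; apply: (le_lt_trans (edist_triangle (x k) _ _)).
    have : edist (x k) (x k + rho k *: h) <= rho k.
      rewrite edistE opprD addrA subrr add0r enormN enormZ gtr0_norm//.
      by rewrite ler_piMr// ltW.
    by move: kx krho => /=; lra.
  have := hd _ _ (bd _ g1) (bd _ g1').
  rewrite opprD addrACA subrr add0r -scalerBr enormZ gtr0_norm// linearZ /=.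
  set h := psi e - psi e' => hh.
  have h2 : enorm h <= 2 by have := enormD (psi e) (- psi e'); rewrite enormN; lra.
  have Lh : enorm (L h - L (e - e')) <= 2 * q.
    rewrite -linearB /= (le_trans (LM _))// -ler_pdivlMl// mulrC mulrAC.
    have -> : h - (e - e') = (e' - psi e') - (e - psi e).
      by apply/rowP => i; rewrite !mxE; ring.
    apply: (le_trans (enormD _ _)); rewrite enormN.
    by move: eg eg'; rewrite !edistE; lra.
  have -> : G e - G e' - rho k *: L (e - e') =
      (G e - G e' - rho k *: L h) + rho k *: (L h - L (e - e')).
    by rewrite scalerBr addrA subrK.
  apply: (le_trans (enormD _ _)); rewrite enormZ gtr0_norm//.
  have a1 : rho k * enorm (L h - L (e - e')) <= rho k * (2 * q) by rewrite ler_pM2l.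
  have a2 : q * (rho k * enorm h) <= q * (rho k * 2) by rewrite !ler_pM2l.
  by move: hh; rewrite -/(G e) -/(G e'); lra.
have e0in : e0 \in e0 :: map phi s by rewrite mem_head.
have phiin w : w \in s -> phi w \in e0 :: map phi s.
  by move=> ws; rewrite inE map_f ?orbT.
have rk := rho_gt0 k.
have r'0 : 0 < rho k * (4 * q) by rewrite mulr_gt0// mulr_gt0.
have r1' : 4 * q < 2 * K * r1.
  have : 8 * q <= 8 * q * K by rewrite ler_peMr// mulr_ge0// ltW.
  have : r1 <= r1 * K by rewrite ler_peMr// ltW.
  by move: rr1; rewrite qE; lra.
have -> : C * (4 * (K * K)) `^ alpha * (r1 / r) `^ alpha =
    C * ((rho k * (2 * K * r1)) / (rho k * (4 * q))) `^ alpha.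
  rewrite -mulrA -powRM ?mulr_ge0 ?invr_ge0 ?(ltW K0) ?(ltW r0) ?(ltW r10)//.
  congr (_ * _ `^ _); rewrite qE; field.
  by rewrite !gt_eqF.
have Fpsi e : e \in e0 :: map phi s -> (f @` F) (G e).
  by move=> /hpsi[[_ ?] _]; exists (x k + rho k *: psi e).
apply: (packing_le_map (g := G \o phi) ss _ _ (hC _ _ _ (Fpsi _ e0in) r'0 _)).
- move=> v w vs ws; rewrite !edistE /= => vw.
  have [_ pv] := hphi v vs; have [_ pw] := hphi w ws.
  have := pL (phi v - phi w); rewrite linearB /= pv pw => h.
  have {}h : 8 * q < enorm (L (phi v - phi w)).
    by rewrite -(ltr_pM2l K0); move: vw; rewrite qE; lra.
  have gd := Gdiff _ _ (phiin v vs) (phiin w ws).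
  have : rho k * enorm (L (phi v - phi w)) <=
      enorm (G (phi v) - G (phi w)) + rho k * (4 * q).
    rewrite -[rho k * enorm _]ger0_norm ?mulr_ge0 ?enorm_ge0 ?(ltW rk)//.
    rewrite normrM (ger0_norm (enorm_ge0 _)) -enormZ.
    set a := rho k *: _ in gd *; set b := G (phi v) - G (phi w) in gd *.
    rewrite -[a](subKr b) (le_trans (enormD _ _))// enormN lerD2l//.
  have : rho k * (8 * q) < rho k * enorm (L (phi v - phi w)) by rewrite ltr_pM2l.
  lra.
- move=> w ws; split; first exact/Fpsi/phiin.
  have [_ pw] := hphi w ws.
  have gd := Gdiff _ _ e0in (phiin w ws).
  rewrite /eball /= edistE -[G e0 - _](subrK (rho k *: L (e0 - phi w))).
  apply: (le_trans (enormD _ _)); rewrite enormZ gtr0_norm//.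
  have : enorm (L (e0 - phi w)) <= K * r1.
    by rewrite (le_trans (Lp _))// ler_pM2l// linearB /= pw sball.
  move=> h; have : rho k * enorm (L (e0 - phi w)) <= rho k * (K * r1).
    by rewrite ler_pM2l.
  have : rho k * (4 * q) <= rho k * (K * r1).
    rewrite ler_pM2l//.
    have : 8 * q <= 8 * q * K by rewrite ler_peMr// mulr_ge0// ltW.
    have : r1 <= r1 * K by rewrite ler_peMr// ltW.
    by move: rr1; rewrite qE; lra.
  lra.
- by rewrite ltr_pM2l.
Qed.

End transfer.

(** * A weak tangent of full dimension *)

Section dimension_of_tangent.
Context {R : realType} {n : nat}.
Implicit Types (E F : set 'rV[R]_n).

Lemma hausdorff_cost_ge0 (s : R) E : (0 <= hausdorff_cost s E)%E.
Proof. by rewrite /hausdorff_cost; case: ifP => // _; exact: poweR_ge0. Qed.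

Lemma sum_truncated_le (c : R) (N k : nat) : 0 <= c ->
  \sum_(0 <= i < k) (if (i < N)%N then c else 0) <= N%:R * c.
Proof.
move=> c0; rewrite -big_mkcond /= big_const_seq iter_addr addr0 -[c *+ _]mulr_natl.
rewrite ler_wpM2r// ler_nat -size_filter.
rewrite -[leqRHS](size_iota 0 N); apply: uniq_leq_size.
  by rewrite filter_uniq// iota_uniq.
by move=> i; rewrite mem_filter mem_iota => /andP[].
Qed.

(** [E] lies in a ball of radius [D] around one of its points, so it is covered
    by at most [C (D / r) ^ alpha] sets of diameter [r], of total cost
    [C D ^ alpha r ^ (beta - alpha)], which tends to [0] with [r]. *)
Lemma hausdorff_measure_eq0 E (alpha beta : R) : (0 < n)%N -> bounded_set E ->
  0 < beta -> alpha < beta -> assouad_exponent E alpha ->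
  hausdorff_measure beta E = 0%E.
Proof.
move=> n0 /bounded_enormP[M EM] b0 ab [C C0 hC].
have cost0 : hausdorff_cost beta (@set0 'rV[R]_n) = 0%E.
  by rewrite /hausdorff_cost eqxx.
have pre_ge0 d : (0 <= hausdorff_premeasure beta d E)%E.
  apply: le_ereal_inf_tmp => _ [V _ <-]; apply: nneseries_ge0 => i _ _.
  exact: hausdorff_cost_ge0.
suff pre_le d : 0 < d -> (hausdorff_premeasure beta d E <= 0)%E.
  apply/eqP; rewrite eq_le; apply/andP; split.
    by apply: ge_ereal_sup => _ [d d0 <-]; exact: pre_le.
  apply: le_trans (pre_ge0 1) _; apply: ereal_sup_ubound.
  by exists 1 => //=.
move=> d0; apply/lee_addgt0Pr => eps eps0; rewrite add0e.
have [E0|/set0P[e Ee]] := eqVneq E set0.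
  apply: (@le_trans _ _ 0%E); last by rewrite lee_fin ltW.
  apply: ereal_inf_lbound; exists (fun=> set0).
    split=> [|i]; first by rewrite E0.
    rewrite (@le_trans _ _ 0%E)//; last by rewrite lee_fin ltW.
    by apply: diam_le.
  by rewrite eseries0.
have M0 : 0 <= M by rewrite (le_trans _ (EM _ Ee))// enorm_ge0.
pose D := 2 * M + 1; have D0 : 0 < D by rewrite /D; lra.
have CD : 0 < C * D `^ alpha by rewrite mulr_gt0// powR_gt0.
have bound0 : 0 < Num.min d (D / 2).
  by rewrite lt_min d0 divr_gt0.
have ba : 0 < beta - alpha by rewrite subr_gt0.
have [r [r0 rle rpow]] := small_powR bound0 ba (divr_gt0 eps0 CD).
have rD : r < D by move: rle; rewrite le_min => /andP[_]; lra.
have rd : r <= d by move: rle; rewrite le_min => /andP[].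
have [N [V [NC dV EV]]] := hC e r D Ee r0 rD.
pose W i := if insub i is Some j then V j else set0.
apply: (@le_trans _ _ (\sum_(0 <= i <oo) hausdorff_cost beta (W i))%E).
  apply: ereal_inf_lbound; exists W => //; split.
    move=> y Ey; have [|j _ Vy] := EV y.
      split => //; rewrite /eball /= edistE.
      by have := enormD e (- y); rewrite enormN; have := EM _ Ey; have := EM _ Ee; rewrite /D; lra.
    by exists j => //; rewrite /W valK.
  move=> i; rewrite /W; case: insubP => [j _ _|_]; first by rewrite dV lee_fin.
  apply: (@le_trans _ _ 0%E); last by rewrite lee_fin ltW.
  by apply: diam_le.
apply: lime_le; first by apply: is_cvg_nneseries => i _ _; exact: hausdorff_cost_ge0.
apply: nearW => k.
apply: (@le_trans _ _ (\sum_(0 <= i < k) (if (i < N)%N then r `^ beta else 0)%:E)%E).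
  apply: lee_sum => i _; rewrite /W; case: insubP => [j jN _|]; last first.
    by move=> /negPf ->; rewrite cost0.
  rewrite jN /hausdorff_cost; case: ifP => _; first by rewrite lee_fin powR_ge0.
  by rewrite dV poweR_EFin.
rewrite sumEFin lee_fin; apply: (le_trans (sum_truncated_le _ _ (powR_ge0 _ _))).
have -> : r `^ beta = r `^ (beta - alpha) * r `^ alpha.
  by rewrite -powRD ?subrK// gt_eqF// implybT.
have h1 : N%:R * r `^ alpha <= C * D `^ alpha.
  have -> : C * D `^ alpha = C * (D / r) `^ alpha * r `^ alpha.
    rewrite -mulrA -powRM ?divr_ge0 ?(ltW r0) ?(ltW D0)//.
    by rewrite divfK// gt_eqF.
  by rewrite ler_wpM2r ?powR_ge0// ltW.
have h2 : r `^ (beta - alpha) * (C * D `^ alpha) <= eps by rewrite -ler_pdivlMr.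
apply: le_trans h2; rewrite mulrCA ler_wpM2l ?powR_ge0//.
Qed.

Lemma hausdorff_dim_le_assouad_dim E : (0 < n)%N -> bounded_set E ->
  (hausdorff_dim E <= assouad_dim E)%E.
Proof.
move=> n0 Eb; apply: le_ereal_inf_tmp => _ [alpha [a0 ha] <-].
apply/lee_addgt0Pr => eps eps0; apply: ereal_inf_lbound.
exists (alpha + eps) => //; split; first by rewrite addr_ge0// ltW.
apply: hausdorff_measure_eq0 ha => //; first by rewrite ltr_wpDl.
by rewrite ltrDl.
Qed.

Lemma ereal_cofinal_seq (s : \bar R) : exists t : nat -> R,
  (forall k, (0 <= s -> (t k)%:E < s)%E) /\
  forall r, (r%:E < s)%E -> \forall k \near \oo, r <= t k.
Proof.
case: s => [s| |].
- exists (fun k => s - k.+1%:R^-1); split=> [k _|r].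
    by rewrite lte_fin ltrBlDr ltrDl.
  rewrite lte_fin -subr_gt0 => sr; near=> k.
  rewrite lerBrDr -lerBrDl; apply: ltW; near: k.
  exact: near_infty_natSinv_lt (PosNum sr).
- exists (fun k => k%:R); split=> [k _|r _]; first exact: ltry.
  near=> k; near: k; exact: nbhs_infty_ger.
- by exists (fun=> 0); split.
Unshelve. all: by end_near. Qed.

(** At stage [k] an inefficient ball is chosen for an exponent [t k], where
    [t k] increases to the Assouad dimension; by [efficient_coverW] it is
    inefficient for all smaller exponents too, so one sequence serves all
    [t < assouad_dim F].  The centers stay near [F] because a ball that misses
    [F] is covered by the empty family. *)
Lemma exists_inefficient_blowups F : (0 < n)%N -> F !=set0 -> bounded_set F ->
  exists (x : nat -> 'rV[R]_n) (rho : nat -> R), [/\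
    forall k, 0 < rho k <= 2 ^- k,
    forall k, exists2 y, F y & edist (x k) y <= 1 &
    forall t, 0 <= t -> (t%:E < assouad_dim F)%E ->
      \forall k \near \oo, ~ efficient_cover F t k (x k) (rho k)].
Proof.
move=> n0 [y0 Fy0] Fb; set s := assouad_dim F.
have s0 : (0 <= s)%E by apply: le_ereal_inf_tmp => _ [a [a0 _] <-]; rewrite lee_fin.
have [t [ts tr]] := ereal_cofinal_seq s.
have p2 k : 0 < 2 ^- k :> R by rewrite invr_gt0 exprn_gt0.
have p21 k : 2 ^- k <= 1 :> R by rewrite invf_le1 ?exprn_gt0// exprn_ege1 ?ler1n.
have /choice[q hq] : forall k, exists q : 'rV[R]_n * R, [/\ 0 < q.2 <= 2 ^- k,
    exists2 y, F y & edist q.1 y <= 1 &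
    0 <= t k -> ~ efficient_cover F (t k) k q.1 q.2].
  (* A negative t k asks for nothing: this occurs when s = 0. *)
  move=> k; have [tk0|tk0] := leP 0 (t k); last first.
    exists (y0, 2 ^- k); split; rewrite /= ?p2 ?lexx//.
    by exists y0 => //; rewrite edistxx.
  (* Otherwise t k would be an exponent below the infimum s of all exponents. *)
  have [x [rho [rho0 rhole neff]]] : exists x rho, [/\ 0 < rho, rho <= 2 ^- k &
      ~ efficient_cover F (t k) k x rho].
    apply: contrapT => h.
    suff : (s <= (t k)%:E)%E by rewrite leNgt ts.
    apply: ereal_inf_lbound; exists (t k) => //; split => //.
    apply: (efficient_cover_exponent (k := k) n0 Fb tk0 (p2 k)) => x rho rho0 rhole.
    by apply: contrapT => neff; apply: h; exists x, rho.
  exists (x, rho); split => //=; first by rewrite rho0.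
  apply: contrapT => h; apply: neff; exists [::]; split => //.
    move=> y Fy xy; exfalso; apply: h; exists y => //.
    by rewrite (le_trans xy)// (le_trans rhole).
  by rewrite big_nil.
exists (fun k => (q k).1), (fun k => (q k).2); split=> [k|k|r r0 rs].
- by have [] := hq k.
- by have [] := hq k.
- apply: filterS (tr r rs) => k rt; have [_ _ h] := hq k.
  by move=> /(efficient_coverW rt); apply: h; exact: le_trans rt.
Qed.

Lemma exists_full_dimensional_tangent F :
  (0 < n)%N -> F !=set0 -> bounded_set F ->
  exists U x rho z, [/\ UltraFilter U, forall k : nat, 0 < rho k :> R,
    forall eps, 0 < eps -> \forall k \near U, rho k < eps,
    forall eps, 0 < eps -> \forall k \near U, edist z (x k) < eps &
    hausdorff_dim (weak_tangent F U x rho) = assouad_dim F].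
Proof.
move=> n0 F0 Fb; have [x [rho [hrho hx heff]]] := exists_inefficient_blowups n0 F0 Fb.
have [U [UU Uoo]] := @ultraFilterLemma nat \oo _.
have rho0 k : 0 < rho k by have /andP[] := hrho k.
have rhoc eps : 0 < eps -> \forall k \near U, rho k < eps.
  move=> e0; have e20 : 0 < eps / 2 by rewrite divr_gt0.
  apply: filterS (Uoo _ (near_expVn_le e20)) => k ke.
  by have /andP[_ h] := hrho k; rewrite (le_lt_trans h)// (le_lt_trans ke)//; lra.
have /bounded_enormP[M FM] := Fb.
have [|z _ xz] := compact_ultra_cvg (f := x) UU (@compact_eball R n 0 (M + 1)).
  apply: nearW => k; have [y Fy xy] := hx k.
  rewrite /eball /= (le_trans (edist_triangle y _ _))//.
  by rewrite edistE sub0r enormN edistC lerD// FM.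
have xc eps : 0 < eps -> \forall k \near U, edist z (x k) < eps.
  move=> e0; have : nbhs z (open_eball z eps) by apply/nbhs_edistP; exists eps.
  exact: xz.
exists U, x, rho, z; split => //; apply/eqP; rewrite eq_le; apply/andP; split.
  apply: (le_trans (hausdorff_dim_le_assouad_dim n0 _)).
    by apply/bounded_enormP; exists 1 => e; exact: weak_tangent_enorm.
  apply: le_ereal_inf => _ [alpha [a0 ha] <-]; exists alpha => //; split => //.
  have := @assouad_exponent_weak_tangent _ _ F U UU x rho z rho0 rhoc xc
    idfun idfun idfun 1 alpha n0.
  rewrite !image_id; apply => // [eps eps0|v|v]; last 2 first.
  - by rewrite mul1r.
  - by rewrite mul1r.
  exists 1 => // u v _ _; rewrite /= subrr enorm0.
  by rewrite mulr_ge0 ?enorm_ge0// ltW.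
apply: le_ereal_inf_tmp => _ [t [t0 Ht] <-]; rewrite leNgt; apply/negP => ts.
have [t' tt' t's] : exists2 t', t < t' & (t'%:E < assouad_dim F)%E.
  have [v [vs tv]] := ereal_cofinal_seq (assouad_dim F).
  case: (assouad_dim F) ts => [s| |//].
  - rewrite lte_fin => ts; exists ((t + s) / 2); rewrite ?lte_fin; lra.
  - by move=> _; exists (t + 1); rewrite ?ltrDl// ltry.
have : \forall k \near U, ~ efficient_cover F t' k (x k) (rho k).
  by apply: Uoo; apply: heff => //; rewrite (le_trans t0)// ltW.
by move=> /(weak_tangent_measure_neq0 UU rho0 Uoo t0 tt'); apply.
Qed.

End dimension_of_tangent.

(** * Continuously differentiable maps *)

Section strict_differentiability.
Context {R : realType} {n : nat}.
Implicit Types (f : 'rV[R]_n -> 'rV[R]_n) (u v h z : 'rV[R]_n).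

Lemma is_derive_line_coord f v h (s : R) (i : 'I_n) :
  differentiable f (v + s *: h) ->
  is_derive s 1 (fun s : R => f (v + s *: h) 0 i : R)
    ((h *m 'J f (v + s *: h)) 0 i).
Proof.
move=> df; pose g : R -> 'rV[R]_n := fun s => v + s *: h.
have dg : is_diff s g (cst 0 + ( *:%R ^~ h)).
  exact: is_diffD.
have dgs : differentiable g s by exact: ex_diff.
have dfg : differentiable (f \o g) s by exact: differentiable_comp.
have der : derivable (f \o g) s 1 by apply/derivable1_diffP.
have val : 'D_1 (f \o g) s = h *m 'J f (v + s *: h).
  rewrite deriveE// diff_comp//.
  rewrite [in LHS]/= diff_val /= !fctE /= add0r scale1r.
  by rewrite -deriveE// deriveEjacobian.
have /derivable_mxP/(_ 0 i) der_i := der.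
apply: DeriveDef; first exact: der_i.
by rewrite -val derive_mx// mxE.
Qed.

Lemma mean_value_coord f v h (i : 'I_n) :
  (forall s : R, 0 <= s <= 1 -> differentiable f (v + s *: h)) ->
  exists2 c : R, 0 <= c <= 1 &
    f (v + h) 0 i - f v 0 i = (h *m 'J f (v + c *: h)) 0 i.
Proof.
move=> df; pose phi (s : R) : R := f (v + s *: h) 0 i.
pose dphi (s : R) : R := (h *m 'J f (v + s *: h)) 0 i.
have der (s : R) : s \in `[0, 1]%R -> is_derive s 1 phi (dphi s).
  by rewrite in_itv /= => s01; apply: is_derive_line_coord; exact: df.
have der_oo (s : R) : s \in `]0, 1[%R -> is_derive s 1 phi (dphi s).
  by move=> s01; apply: der; apply: subset_itv_oo_cc.
have cont : {within `[0, 1], continuous phi}.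
  by apply: derivable_within_continuous => s /der[].
have [c c01] := MVT_segment ler01 der_oo cont.
rewrite subr0 mulr1 /phi scale1r scale0r addr0 => E; by exists c.
Qed.

Lemma norm_mulmx_coord h (M : 'M[R]_n) (e : R) (i : 'I_n) :
  (forall j, `|M j i| <= e) -> `|(h *m M) 0 i| <= n%:R * (`|h| * e).
Proof.
move=> Me; rewrite mxE; apply: (le_trans (ler_norm_sum _ _ _)).
apply: (@le_trans _ _ (\sum_(j < n) `|h| * e)); last first.
  by rewrite sumr_const card_ord mulr_natl.
by apply: ler_sum => j _; rewrite normrM ler_pM// coord_le_norm.
Qed.

(** By the mean value theorem, coordinate [i] of [f u - f v] is that of
    [(u - v) *m 'J f w] for some [w] on the segment from [v] to [u], and ['J f w]
    is close to ['J f z] since [w] is close to [z]. *)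
Lemma C1_strictly_differentiable f z :
  (\forall z' \near z, differentiable f z') ->
  {for z, continuous (jacobian f)} ->
  strictly_differentiable f (mulmxr ('J f z)) z.
Proof.
move=> df Jc eps eps0; have [K K1 normK] := @enorm_le_norm R n.
have K0 : 0 < K by apply: lt_le_trans K1.
pose e : R := eps / (K * n.+1%:R).
have e0 : 0 < e by rewrite divr_gt0// mulr_gt0.
have nearJ : \forall z' \near z, ball ('J f z) e ('J f z').
  by apply: Jc; exact: nbhsx_ballx.
have [d d0 hd] := (nbhs_edistP z _).1 (filterI df nearJ).
exists d => // u v zu zv; set h := u - v.
have line (s : R) : 0 <= s <= 1 -> edist z (v + s *: h) < d.
  move=> /andP[s0 s1].
  have -> : edist z (v + s *: h) = enorm ((1 - s) *: (z - v) + s *: (z - u)).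
    by rewrite edistE /h; congr enorm; apply/rowP => i; rewrite !mxE; ring.
  rewrite (le_lt_trans (enormD _ _))// !enormZ.
  rewrite (ger0_norm s0) ger0_norm ?subr_ge0//.
  move: zu zv; rewrite !edistE; set a := enorm _; set b := enorm _ => ad bd.
  have [->|s_neq0] := eqVneq s 0; first by rewrite subr0 mul1r mul0r addr0.
  have {s_neq0} s0' : 0 < s by rewrite lt_neqAle eq_sym s_neq0.
  have : s * a < s * d by rewrite ltr_pM2l.
  have : (1 - s) * b <= (1 - s) * d by rewrite ler_wpM2l ?subr_ge0// ltW.
  lra.
have coord i : `|(f u - f v - mulmxr ('J f z) h) 0 i| <= n%:R * (`|h| * e).
  have [|c c01 hc] := @mean_value_coord f v h i.
    by move=> s /line /hd[].
  have -> : (f u - f v - mulmxr ('J f z) h) 0 i =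
      (h *m ('J f (v + c *: h) - 'J f z)) 0 i.
    rewrite mulmxBr /= [LHS]mxE [RHS]mxE; congr (_ + _).
    by rewrite -hc !mxE [v + h]addrC /h subrK.
  apply: norm_mulmx_coord => j; have [_ bJ] := hd _ (line c c01).
  set A := 'J f (v + _) in bJ *; set B := 'J f z in bJ *.
  rewrite [(A - B) j i]mxE [(- B) j i]mxE distrC; apply: ltW.
  by move: bJ => [_ /(_ j i)].
apply: (le_trans (normK _)); rewrite mulrC -ler_pdivlMr//.
rewrite {1}/Num.norm /= mx_normrE; apply/bigmax_leP; split => [|[j i] _ /=].
  by rewrite !mulr_ge0 ?invr_ge0 ?enorm_ge0// ltW.
rewrite ord1; apply: (le_trans (coord i)).
have -> : eps * enorm h / K = n.+1%:R * (enorm h * e).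
  have N0 : n.+1%:R != 0 :> R by [].
  by rewrite /e; move: (n.+1%:R) N0 => N N0; field; rewrite N0 gt_eqF.
apply: ler_pM => //; first by rewrite mulr_ge0// ltW.
  by rewrite ler_nat.
by rewrite ler_pM2r// norm_le_enorm.
Qed.

End strict_differentiability.

(** * Orthogonal projections *)

Section orthogonal_projection.
Context {R : realType} {n : nat}.
Implicit Types (V W : {vspace 'rV[R]_n}) (v : 'rV[R]_n) (M : 'M[R]_n).

Lemma dim_fullv_rV k : \dim {:'rV[R]_k} = k.
Proof. by rewrite dimvf dim_matrix; exact: mul1n. Qed.

Lemma cap_orth_compl V : (V :&: orth_compl V = 0)%VS.
Proof.
apply/eqP; rewrite -subv0; apply/subvP => v.
rewrite memv_cap => /andP[vV /mem_orthovP/(_ v vV) vv].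
rewrite memv0; apply: contraT => v0.
by have := inner_gt0 v0; rewrite vv ltxx.
Qed.

(** The complement meets [V] trivially, which bounds its dimension from above; it
    contains the kernel of the [\dim V] inner products with a basis of [V], which
    bounds it from below. *)
Lemma dim_orth_compl V : \dim (orth_compl V) = (n - \dim V)%N.
Proof.
have dimR := dim_fullv_rV n.
apply/eqP; rewrite eqn_leq; apply/andP; split.
  rewrite leq_subRL; last by rewrite -[leqRHS]dimR dimvS// subvf.
  rewrite -(dimv_disjoint_sum (cap_orth_compl V)) -[leqRHS]dimR.
  by rewrite dimvS// subvf.
pose phi : 'rV[R]_n -> 'rV[R]_(\dim V) := fun u => \row_i inner u (vbasis V)`_i.
have phi_lin : linear phi.
  move=> a u v; apply/rowP => i; rewrite !mxE linearDl /=.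
  by rewrite innerZl.
pose phiM := GRing.isLinear.Build _ _ _ _ _ phi_lin.
pose phiL : {linear 'rV[R]_n -> 'rV[R]_(\dim V)} := HB.pack phi phiM.
have ker_sub : (lker (linfun phiL) <= orth_compl V)%VS.
  apply/subvP => u; rewrite memv_ker lfunE /= => /eqP u0.
  apply/mem_orthovP => v /coord_vbasis ->; rewrite linear_sumr big1// => i _.
  rewrite /= linearZr /=; have /rowP/(_ i) := u0; rewrite !mxE => ->.
  by rewrite mulr0.
apply: leq_trans (dimvS ker_sub); rewrite leq_subLR -[leqLHS]dimR addnC.
rewrite -(limg_ker_dim (linfun phiL) fullv) capfv leq_add2l.
apply: leq_trans (dimvS (subvf _)) _.
by rewrite dim_fullv_rV.
Qed.

Lemma orth_complK V : orth_compl (orth_compl V) = V.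
Proof.
apply/esym/eqP; rewrite eqEdim; apply/andP; split.
  apply/subvP => v vV; apply/mem_orthovP => w /mem_orthovP/(_ v vV) wv.
  exact: etrans (innerC v w) wv.
rewrite !dim_orth_compl leq_subLR addnC -leq_subLR leqnn //.
Qed.

Lemma lker_orth_proj V : lker (orth_proj V) = orth_compl V.
Proof.
have cap0 := cap_orth_compl V.
have full : (V + orth_compl V)%VS = fullv.
  apply/eqP; rewrite eqEdim subvf dimv_disjoint_sum// dim_orth_compl.
  by rewrite dim_fullv_rV /= -leq_subLR.
have decomp w : orth_proj V w + daddv_pi (orth_compl V) V w = w.
  by apply: daddv_pi_add; rewrite // full memvf.
apply/eqP; rewrite eqEsubv; apply/andP; split; apply/subvP => w.
  rewrite memv_ker => /eqP w0; rewrite -(decomp w) w0 add0r.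
  exact: memv_pi.
move=> wV; rewrite memv_ker -memv0 -cap0 memv_cap memv_pi /=.
rewrite -[orth_proj V w](addrK (daddv_pi (orth_compl V) V w)) decomp.
by rewrite rpredB// memv_pi.
Qed.

Lemma lker_orth_proj_ker_perp (f : 'rV[R]_n -> 'rV[R]_n) (z : 'rV[R]_n) :
  lker (orth_proj (ker_perp f z)) = lker (linfun (mulmxr ('J f z))).
Proof. by rewrite lker_orth_proj orth_complK. Qed.

(** [f] factors through [g] as [(f \o g^-1) \o g], and linear maps are
    bounded. *)
Lemma lfun_bound_of_lker (f g : 'End('rV[R]_n)) : (lker g <= lker f)%VS ->
  exists2 K, 1 <= K & forall v, enorm (f v) <= K * enorm (g v).
Proof.
move=> gf; have [K K1 hK] := enorm_linear_bounded (f \o g^-1)%VF.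
exists K => // v; have := hK (g v); rewrite /= comp_lfunE.
suff -> : f (g^-1%VF (g v)) = f v by [].
apply/eqP; rewrite -subr_eq0 -linearB -memv_ker; apply: (subvP gf).
by rewrite memv_ker linearB /= limg_lfunVK ?subrr// memv_img// memvf.
Qed.

(** Through the rank factorisation [M = col_base M *m row_base M], the image of
    [M] is that of the injective map [mulmxr (row_base M)]. *)
Lemma dim_limg_mulmxr M :
  \dim (limg (linfun (mulmxr M) : 'End('rV[R]_n))) = \rank M.
Proof.
pose phi : 'Hom('rV[R]_(\rank M), 'rV[R]_n) := linfun (mulmxr (row_base M)).
have -> : limg (linfun (mulmxr M) : 'End('rV[R]_n)) = limg phi.
  apply/eqP; rewrite eqEsubv; apply/andP; split; apply/subvP => _ /memv_imgP[u _ ->].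
    rewrite lfunE /= -{1}(mulmx_base M) mulmxA.
    have -> : u *m col_base M *m row_base M = phi (u *m col_base M) by rewrite lfunE.
    exact: memv_img (memvf _).
  rewrite lfunE /=; have /submxP[D ->] : (u *m row_base M <= M)%MS.
    by rewrite (submx_trans (submxMl _ _))// eq_row_base.
  have -> : D *m M = (linfun (mulmxr M) : 'End('rV[R]_n)) D by rewrite lfunE.
  exact: memv_img (memvf _).
rewrite limg_dim_eq; first by rewrite dim_fullv_rV.
apply/eqP; rewrite -subv0; apply/subvP => u; rewrite memv_cap memv_ker lfunE /=.
rewrite memv0 => /andP[_ /eqP u0]; apply/eqP.
by apply: (row_free_inj (row_base_free M)); rewrite u0 mul0mx.
Qed.

Lemma dim_ker_perp (f : 'rV[R]_n -> 'rV[R]_n) (z : 'rV[R]_n) :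
  \dim (ker_perp f z) = \rank ('J f z).
Proof.
rewrite dim_orth_compl -(dim_limg_mulmxr ('J f z)).
have := limg_ker_dim (linfun (mulmxr ('J f z)) : 'End('rV[R]_n)) fullv.
rewrite capfv dim_fullv_rV; set a := \dim _; set b := \dim _ => ab.
by rewrite -[X in (X - _)%N]ab addKn.
Qed.

End orthogonal_projection.

(** * The projection theorem *)

Lemma tangent_map_ker_perp (R : realType) (n : nat) (m : 'I_n.+1)
    (Omega : pmetricType R) (Pi : Omega -> 'rV[R]_n -> 'rV[R]_n) z t :
  \rank ('J (Pi t) z) = m ->
  gr_space (tangent_map (m := m) Pi z t) = ker_perp (Pi t) z.
Proof.
move=> rk; apply: (insubdK (point : grassmannian R m)).
by rewrite unfold_in /= dim_ker_perp rk.
Qed.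

(** The projection onto [ker_perp f z] and the derivative ['J f z] have the same
    kernel, so each bounds the other. *)
Lemma assouad_dim_projection_tangent_le (R : realType) (n : nat) (m : 'I_n.+1)
    (F : set 'rV[R]_n) (f : 'rV[R]_n -> 'rV[R]_n) (U : set_system nat)
    (UU : UltraFilter U) (x : nat -> 'rV[R]_n) (rho : nat -> R) (z : 'rV[R]_n) :
  (0 < n)%N -> C1_constant_rank_near m f z ->
  (forall k, 0 < rho k) ->
  (forall eps, 0 < eps -> \forall k \near U, rho k < eps) ->
  (forall eps, 0 < eps -> \forall k \near U, edist z (x k) < eps) ->
  (assouad_dim (orth_proj (ker_perp f z) @` weak_tangent F U x rho)
    <= assouad_dim (f @` F))%E.
Proof.
move=> n0 C1 rho0 rhoc xc; apply: le_ereal_inf => _ [alpha [a0 ha] <-].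
exists alpha => //; split => //.
set p := orth_proj _; pose L : 'End('rV[R]_n) := linfun (mulmxr ('J f z)).
have kerE : lker p = lker L := lker_orth_proj_ker_perp f z.
have [K1 K11 pL] : exists2 K, 1 <= K & forall v, enorm (p v) <= K * enorm (L v).
  by apply: lfun_bound_of_lker; rewrite kerE subvv.
have [K2 K21 Lp] : exists2 K, 1 <= K & forall v, enorm (L v) <= K * enorm (p v).
  by apply: lfun_bound_of_lker; rewrite kerE subvv.
have K10 : 0 <= K1 by apply: le_trans K11.
have K20 : 0 <= K2 by apply: le_trans K21.
apply: (assouad_exponent_weak_tangent UU rho0 rhoc xc n0
  (L := mulmxr ('J f z)) (p := p) (K := K1 + K2) _ _ _ _ ha).
- apply: C1_strictly_differentiable; first by apply: filterS C1 => ? [].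
  by have [] := nbhs_singleton C1.
- by rewrite (le_trans K11)// lerDl.
- move=> v; rewrite (le_trans (pL v))// lfunE /= ler_wpM2r ?enorm_ge0//.
  by rewrite lerDl.
- move=> v; have := Lp v; rewrite lfunE /= => h.
  by rewrite (le_trans h)// ler_wpM2r ?enorm_ge0// lerDr.
Qed.

Theorem theorem2p2 (R : realType) (n : nat) (m : 'I_n.+1)
    (Omega : pmetricType R) (Pi : Omega -> 'rV[R]_n -> 'rV[R]_n)
    (mu : {measure set (borel Omega) -> \bar R})
    (P : {measure set (borel (grassmannian R m)) -> \bar R})
    (hPi : generalised_projections Pi mu P)
    (F : set 'rV[R]_n) (F0 : F !=set0) (Fb : bounded_set F) :
  {ae mu, forall t,
    (ereal_inf [set ess_inf P (fun V => assouad_dim (orth_proj V @` E)) | E in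
       [set E : set 'rV[R]_n | hausdorff_dim E = assouad_dim F]]
     <= assouad_dim (Pi t @` F))%E}.
Proof.
have [m1 hC1 hac] := hPi.
have n0 : (0 < n)%N by rewrite (leq_trans m1)// -ltnS.
have [U [x [rho [z [UU rho0 rhoc xc dimE]]]]] := exists_full_dimensional_tangent n0 F0 Fb.
set E := weak_tangent F U x rho in dimE.
pose g (V : borel (grassmannian R m)) := assouad_dim (orth_proj V @` E).
have [A [mA PA0 hA]] := ess_inf_le P g.
have nA : {ae mu, forall t, ~ A (tangent_map Pi z t)}.
  apply: negligibleS (hac z A mA PA0) => t /= At; exact: contrapT At.
have FF := ae_filter_ringOfSetsType mu.
apply: filterS2 (hC1 z) nA => t C1 At.
have [_ _ rk] := nbhs_singleton C1.
apply: (@le_trans _ _ (ess_inf P g)); first by apply: ereal_inf_lbound; exists E.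
apply: (@le_trans _ _ (g (tangent_map Pi z t))).
  by apply: contrapT => gt; apply: At; exact: hA.
rewrite /g tangent_map_ker_perp//.
exact: assouad_dim_projection_tangent_le C1 rho0 rhoc xc.
Qed.
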